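(* Let $B$ be an algebra and let $(J_i)_{i\in I}$ be a complete covering of $B$. Then $$\bigcap_{i\neq k}(J_i+J_k)=\Bigl(\bigcap_{i\neq k}J_i\Bigr)+J_k\qquad\text{for all } k\in I,$$ where the intersections run over all $i\in I$ with $i\neq k$.
   Context: Algebras are associative unital algebras over $\mathbb{C}$; ideals are two-sided. An empty intersection of ideals of $B$ is understood as $B$. A finite family $(J_i)_{i\in I}$ of ideals of $B$ is a covering of $B$ if $\bigcap_{i\in I} J_i=\{0\}$. Put $B_i=B/J_i$, $B_{ij}=B/(J_i+J_j)$, let $\pi_i:B\to B_i$ be the quotient maps and $\pi^i_j:B_i\to B_{ij}$, $b+J_i\mapsto b+J_i+J_j$. The covering completion of $B$ is $B_c=\{(a_i)_{i\in I}\in\bigoplus_{i\in I}B_i \mid \pi^i_j(a_i)=\pi^j_i(a_j)\ \forall i,j\in I\}$. The covering is called complete if the (injective) homomorphism $K:B\to B_c$, $K(a)=(\pi_i(a))_{i\in I}$, is surjective. *)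

(* Defs.v *)
From HB Require Import structures.
From mathcomp Require Import all_boot all_order all_algebra.
From mathcomp Require Import boolp classical_sets functions.

Set Implicit Arguments.
Unset Strict Implicit.
Unset Printing Implicit Defensive.

Import GRing.Theory.
Local Open Scope ring_scope.
Local Open Scope quotient_scope.
Local Open Scope classical_set_scope.

(* GRing.Algebra extends nzRingType, which excludes the zero algebra, although
   quotients of an algebra by ideals can be zero. We use the same axioms over a
   pzRingType. The scaling is a field of the mixin because the hierarchy has no
   join of pzRingType and lmodType below the nonzero algebras, and does not
   allow one to be added. *)
HB.mixin Record PzRing_isPzAlgebra (F : pzRingType) (A : Type)
    of GRing.PzRing A := {
  ascale : F -> A -> A;
  ascaleA : forall c d x, ascale c (ascale d x) = ascale (c * d) x;
  ascale1 : forall x, ascale 1 x = x;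
  ascaleDr : forall c x y, ascale c (x + y) = ascale c x + ascale c y;
  ascaleDl : forall c d x, ascale (c + d) x = ascale c x + ascale d x;
  ascaleAl : forall c (x y : A), ascale c (x * y) = ascale c x * y;
  ascaleAr : forall c (x y : A), ascale c (x * y) = x * ascale c y
}.

#[short(type="pzAlgType")]
HB.structure Definition PzAlgebra (F : pzRingType) :=
  {A of GRing.PzRing A & PzRing_isPzAlgebra F A}.

Definition alg_of (F : pzRingType) (A : algType F) : Type := A.

HB.instance Definition _ (F : pzRingType) (A : algType F) :=
  GRing.PzRing.on (alg_of A).
HB.instance Definition _ (F : pzRingType) (A : algType F) :=
  PzRing_isPzAlgebra.Build F (alg_of A) (@scalerA F A) (@scale1r F A)
    (@scalerDr F A) (fun c d x => @scalerDl F A x c d) (@scalerAl F A)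
    (@scalerAr F A).

(* Stability under scaling is a consequence, the algebra being unital. *)
Record ideal (F : pzRingType) (B : pzAlgType F) := Ideal {
  ideal_set :> set B;
  ideal0 : ideal_set 0;
  idealB : forall x y, ideal_set x -> ideal_set y -> ideal_set (x - y);
  idealMl : forall b x, ideal_set x -> ideal_set (b * x);
  idealMr : forall b x, ideal_set x -> ideal_set (x * b)
}.

Definition sumset (V : zmodType) (X Y : set V) : set V :=
  [set x + y | x in X & y in Y].

Notation "X :+: Y" := (sumset X Y)
  (at level 50, left associativity) : classical_set_scope.

Section IdealSum.
Variables (F : pzRingType) (B : pzAlgType F) (I J : ideal B).

Lemma idealD0 : (I :+: J) 0.
Proof.
by exists 0; [exact: ideal0|exists 0; [exact: ideal0|rewrite addr0]].
Qed.

Lemma idealDB x y : (I :+: J) x -> (I :+: J) y -> (I :+: J) (x - y).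
Proof.
move=> [a Ia [b Jb <-]] [c Ic [d Jd <-]]; exists (a - c); first exact: idealB.
by exists (b - d); [exact: idealB|rewrite opprD addrACA].
Qed.

Lemma idealDMl b x : (I :+: J) x -> (I :+: J) (b * x).
Proof.
move=> [y Iy [z Jz <-]]; exists (b * y); first exact: idealMl.
by exists (b * z); [exact: idealMl|rewrite mulrDr].
Qed.

Lemma idealDMr b x : (I :+: J) x -> (I :+: J) (x * b).
Proof.
move=> [y Iy [z Jz <-]]; exists (y * b); first exact: idealMr.
by exists (z * b); [exact: idealMr|rewrite mulrDl].
Qed.

Definition idealD : ideal B := Ideal idealD0 idealDB idealDMl idealDMr.

End IdealSum.

Section QuotientAlgebra.
Variables (F : pzRingType) (B : pzAlgType F) (J : ideal B).

Definition ideal_pred : {pred B} := fun x => `[< ideal_set J x >].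

Lemma ideal_predE x : (x \in ideal_pred) = `[< ideal_set J x >].
Proof. by []. Qed.

Lemma ideal_pred_zmod_closed : zmod_closed ideal_pred.
Proof.
split=> [|x y]; rewrite !ideal_predE; first exact/asboolP/ideal0.
by move=> /asboolP Jx /asboolP Jy; apply/asboolP/idealB.
Qed.

HB.instance Definition _ :=
  GRing.isZmodClosed.Build B ideal_pred ideal_pred_zmod_closed.

Definition quotient : Type := Quotient.quot ideal_pred.

HB.instance Definition _ := GRing.Zmodule.on quotient.
HB.instance Definition _ := EqQuotient.on quotient.

Definition proj (b : B) : quotient := \pi_quotient b.

Lemma projP x y : proj x = proj y <-> ideal_set J (x - y).
Proof.
split=> [/eqP|Jxy]; last apply/eqP.
  by rewrite -Quotient.idealrBE ideal_predE => /asboolP.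
by rewrite -Quotient.idealrBE ideal_predE; apply/asboolP.
Qed.

Lemma projK (a : quotient) : proj (repr a) = a.
Proof. exact: reprK. Qed.

Lemma proj_repr x : ideal_set J (repr (proj x) - x).
Proof. by apply/projP; rewrite projK. Qed.

Lemma projB x y : proj (x - y) = proj x - proj y.
Proof. exact: (raddfB (\pi_(Quotient.quot ideal_pred))). Qed.

Lemma projD x y : proj (x + y) = proj x + proj y.
Proof. exact: (raddfD (\pi_(Quotient.quot ideal_pred))). Qed.

Definition quotient_mul (a b : quotient) : quotient := proj (repr a * repr b).
Definition quotient_scale (c : F) (a : quotient) : quotient :=
  proj (ascale c (repr a)).

Lemma projM x y : proj (x * y) = quotient_mul (proj x) (proj y).
Proof.
apply/esym/projP; set u := repr _; set v := repr _.
have -> : u * v - x * y = (u - x) * v - x * - (v - y).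
  by rewrite mulrN opprK mulrBl mulrBr addrA subrK.
apply: idealB; first exact/idealMr/proj_repr.
by rewrite mulrN -mulNr; apply/idealMl/proj_repr.
Qed.

Lemma projZ c x : proj (ascale c x) = quotient_scale c (proj x).
Proof.
apply/esym/projP; set u := repr _.
have -> : ascale c u - ascale c x = ascale c 1 * (u - x).
  by rewrite mulrBr -!ascaleAl !mul1r.
exact/idealMl/proj_repr.
Qed.

Let quotient_ind (P : quotient -> Prop) : (forall x, P (proj x)) -> forall a, P a.
Proof. by move=> Pproj a; rewrite -(projK a). Qed.

Lemma quotient_mulA : associative quotient_mul.
Proof.
elim/quotient_ind=> x; elim/quotient_ind=> y; elim/quotient_ind=> z.
by rewrite -!projM mulrA.
Qed.

Lemma quotient_mul1 : left_id (proj 1) quotient_mul.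
Proof. by elim/quotient_ind=> x; rewrite -projM mul1r. Qed.

Lemma quotient_mulr1 : right_id (proj 1) quotient_mul.
Proof. by elim/quotient_ind=> x; rewrite -projM mulr1. Qed.

Lemma quotient_mulDl : left_distributive quotient_mul +%R.
Proof.
elim/quotient_ind=> x; elim/quotient_ind=> y; elim/quotient_ind=> z.
by rewrite -projD -!projM -projD mulrDl.
Qed.

Lemma quotient_mulDr : right_distributive quotient_mul +%R.
Proof.
elim/quotient_ind=> x; elim/quotient_ind=> y; elim/quotient_ind=> z.
by rewrite -projD -!projM -projD mulrDr.
Qed.

HB.instance Definition _ := GRing.Zmodule_isPzRing.Build quotient
  quotient_mulA quotient_mul1 quotient_mulr1 quotient_mulDl quotient_mulDr.

HB.instance Definition _ := GRing.isZmodMorphism.Build B quotient proj projB.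

Lemma proj_monoid_morphism : monoid_morphism proj.
Proof. by split=> // x y; rewrite projM. Qed.

HB.instance Definition _ :=
  GRing.isMonoidMorphism.Build B quotient proj proj_monoid_morphism.

Lemma quotient_scaleA c d a :
  quotient_scale c (quotient_scale d a) = quotient_scale (c * d) a.
Proof. by elim/quotient_ind: a => x; rewrite -!projZ ascaleA. Qed.

Lemma quotient_scale1 a : quotient_scale 1 a = a.
Proof. by elim/quotient_ind: a => x; rewrite -projZ ascale1. Qed.

Lemma quotient_scaleDr c a b :
  quotient_scale c (a + b) = quotient_scale c a + quotient_scale c b.
Proof.
elim/quotient_ind: a => x; elim/quotient_ind: b => y.
by rewrite -projD -!projZ -projD ascaleDr.
Qed.

Lemma quotient_scaleDl c d a :
  quotient_scale (c + d) a = quotient_scale c a + quotient_scale d a.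
Proof. by elim/quotient_ind: a => x; rewrite -!projZ -projD ascaleDl. Qed.

Lemma quotient_scaleAl c (a b : quotient) :
  quotient_scale c (a * b) = quotient_scale c a * b.
Proof.
elim/quotient_ind: a => x; elim/quotient_ind: b => y.
by rewrite -projZ -!rmorphM -projZ /= ascaleAl.
Qed.

Lemma quotient_scaleAr c (a b : quotient) :
  quotient_scale c (a * b) = a * quotient_scale c b.
Proof.
elim/quotient_ind: a => x; elim/quotient_ind: b => y.
by rewrite -projZ -!rmorphM -projZ /= ascaleAr.
Qed.

HB.instance Definition _ := PzRing_isPzAlgebra.Build F quotient
  quotient_scaleA quotient_scale1 quotient_scaleDr quotient_scaleDl
  quotient_scaleAl quotient_scaleAr.

Lemma proj_scale c x : proj (ascale c x) = ascale c (proj x).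
Proof. exact: projZ. Qed.

End QuotientAlgebra.

(* The maps b + I |-> b + I + J and b + J |-> b + I + J. Both take values in
   B/(I + J): the types of B/(I + J) and B/(J + I) are not convertible. *)
Definition quotl (F : pzRingType) (B : pzAlgType F) (I J : ideal B)
    (a : quotient I) : quotient (idealD I J) := proj (idealD I J) (repr a).

Definition quotr (F : pzRingType) (B : pzAlgType F) (I J : ideal B)
    (a : quotient J) : quotient (idealD I J) := proj (idealD I J) (repr a).

Lemma quotlE (F : pzRingType) (B : pzAlgType F) (I J : ideal B) (b : B) :
  quotl J (proj I b) = proj (idealD I J) b.
Proof.
apply/projP; exists (repr (proj I b) - b); first exact: proj_repr.
by exists 0; [exact: ideal0|rewrite addr0].
Qed.

Lemma quotrE (F : pzRingType) (B : pzAlgType F) (I J : ideal B) (b : B) :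
  quotr I (proj J b) = proj (idealD I J) b.
Proof.
apply/projP; exists 0; first exact: ideal0.
by exists (repr (proj J b) - b); [exact: proj_repr|rewrite add0r].
Qed.

Section Covering.
Variables (F : pzRingType) (B : pzAlgType F) (I : finType) (J : I -> ideal B).

Definition covering : Prop :=
  \bigcap_(i in [set: I]) (J i : set B) = [set 0].

Definition covering_completion : set (forall i, quotient (J i)) :=
  [set a | forall i j, quotl (J j) (a i) = quotr (J i) (a j)].

Definition completion_map (b : B) : forall i, quotient (J i) :=
  fun i => proj (J i) b.

Lemma completion_mapP b : covering_completion (completion_map b).
Proof. by move=> i j; rewrite /completion_map quotlE quotrE. Qed.

Definition complete_covering : Prop :=
  covering /\ set_surj [set: B] covering_completion completion_map.

End Covering.

Arguments covering_completion {F B I} J.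

(* Main.v *)
(* If [a] lies in every [J i + J k] with [i != k], then the family with [k]-th
   component [a + J k] and all other components [0] is compatible. By
   completeness it comes from some [b], and [a = b + (a - b)] is the desired
   decomposition. *)
Require Import Defs.
From mathcomp Require Import all_boot all_order all_algebra.
From mathcomp Require Import classical_sets reals complex.

Import GRing.Theory.

Local Open Scope ring_scope.
Local Open Scope complex_scope.
Local Open Scope classical_set_scope.

Lemma sumsetC (V : zmodType) (X Y : set V) : X :+: Y = Y :+: X.
Proof.
by apply/seteqP; split=> _ [x Xx [y Yy <-]]; exists y => //; exists x;
  rewrite // addrC.
Qed.

(** A Chinese remainder property: equality in [B/(J i + J j)] means that the difference lies in
    [J i + J j], so the classes of the [x i] form a point of the covering completion, and
    surjectivity gives [b]. *)
Lemma complete_covering_lift (F : pzRingType) (B : pzAlgType F) (I : finType)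
    (J : I -> ideal B) (x : I -> B) :
  complete_covering J -> (forall i j, (J i :+: J j) (x i - x j)) ->
  exists b, forall i, ideal_set (J i) (b - x i).
Proof.
move=> [_ Jsurj] xJ.
have [i j|b _ bx] := Jsurj (fun i => proj (J i) (x i)).
  rewrite quotlE quotrE; apply/(@projP _ _ (idealD (J i) (J j))); exact: xJ.
by exists b => i; apply/projP; rewrite -[RHS](congr1 (@^~ i) bx).
Qed.

Theorem proposition4 (R : realType) (B : pzAlgType R[i]) (I : finType)
    (J : I -> ideal B) (hJ : complete_covering J) (k : I) :
  \bigcap_(i in [set i : I | i != k]) ((J i : set B) :+: J k) =
  (\bigcap_(i in [set i : I | i != k]) (J i : set B)) :+: J k.
Proof.
apply/seteqP; split=> [a aJ|_ [b bJ [c Jc <-]] i ik]; last first.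
  by exists b; [exact: bJ|exists c].
have [i j|b bJ] :=
    @complete_covering_lift _ _ _ _ (fun i => if i == k then a else 0) hJ.
  (* If both or neither of [i], [j] equal [k], the difference is [0]; the mixed pairs give [a - 0]
     and [0 - a], which are covered by [aJ]. *)
  have [->|ik] := eqVneq i k; have [->|jk] := eqVneq j k.
  - by rewrite subrr; exact: idealD0.
  - by rewrite subr0 /= sumsetC; exact: aJ.
  - by apply: idealDB; [exact: idealD0|exact: aJ].
  - by rewrite subrr; exact: idealD0.
exists b => [i /= ik|]; first by have := bJ i; rewrite (negPf ik) subr0.
exists (a - b); last by rewrite addrC subrK.
have := bJ k; rewrite eqxx => Jba.
by rewrite -opprB -sub0r; apply: idealB => //; exact: ideal0.
Qed.
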